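(* Let $C\ge 10$, let $d=d(n)\ge 0$ be integers and $p=p(n)\in[0,1]$, and for each $n$ let $G\sim G_{n,p,d}$ be drawn from any $d$-dependent random graph distribution on $n$ vertices with edge probability $p$. Suppose that almost surely the maximum degree of $G$ is at most $(C^2/14)np$ (this supposition is implied if $p\ge 14/C^2$ or $p\ge (d+1)\ln(n)/n$). Then almost surely, all subsets of vertices $A,B$ simultaneously satisfy \[ \Big| e(A,B) - p|A||B| \Big| \leq C\sqrt{|A||B|\,np\,(d+1)}. \]
   Context: A dependency graph for a finite family of random variables $(X_i)_{i\in I}$ is a (simple, undirected) graph on vertex set $I$ such that each $X_i$ is independent of the family of all $X_j$ ($j\ne i$) with $j$ not adjacent to $i$ (the notion used in the Lovász local lemma and Janson's inequality). The variables are $d$-locally dependent if they have a dependency graph of maximum degree at most $d$. A $d$-dependent random graph $G_{n,p,d}$ is any probability distribution on simple graphs on $n$ (labelled) vertices such that each of the $\binom n2$ potential edges is present with probability exactly $p$, and the indicator variables of the edges are $d$-locally dependent. The notation $G\sim G_{n,p,d}$ means $G$ is drawn from such a distribution. The parameters $p$ and $d$ may depend on $n$. An event happens almost surely if its probability tends to $1$ as $n\to\infty$. $\ln$ is the natural logarithm. For sets of vertices $A,B$ (not necessarily disjoint), $e(A,B)$ counts the edges of $G$ having one endpoint in $A$ and the other in $B$, with edges contained in $A\cap B$ counted twice; i.e. $e(A,B)$ is the number of ordered pairs $(a,b)\in A\times B$ such that $ab$ is an edge of $G$. *)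

(* Defs.v *)
From HB Require Import structures.
From mathcomp Require Import all_boot all_order all_algebra.
From mathcomp Require Import all_classical all_reals all_analysis.

Set Implicit Arguments.
Unset Strict Implicit.
Unset Printing Implicit Defensive.

Import Order.TTheory GRing.Theory Num.Theory.
Import numFieldNormedType.Exports.

Local Open Scope classical_set_scope.
Local Open Scope ring_scope.

Notation potential_edge V := {e : {set V} | #|e| == 2%N}.

(* Simple graphs on a finite vertex set, as sets of two-element subsets of [V],
   with the discrete sigma-algebra. *)
Definition simple_graph (V : finType) : Type := {set potential_edge V}.

HB.instance Definition _ (V : finType) :=
  Finite.copy (simple_graph V) {set potential_edge V}.
HB.instance Definition _ (V : finType) :=
  isPointed.Build (simple_graph V) (finset.set0 : {set potential_edge V}).
HB.instance Definition _ (V : finType) :=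
  @isMeasurable.Build default_measure_display (simple_graph V)
    discrete_measurable discrete_measurable0
    discrete_measurableC discrete_measurableU.

Definition edges (V : finType) (G : simple_graph V) : {set potential_edge V} := G.

(* [adj G x x] is false, since [set x; x] has a single element. *)
Definition adj (V : finType) (G : simple_graph V) : rel V :=
  fun x y => [exists e in edges G, val e == [set x; y]%SET].

Definition degree (V : finType) (G : simple_graph V) (x : V) : nat :=
  #|[set y | adj G x y]%SET|.

Definition max_degree (V : finType) (G : simple_graph V) : nat :=
  (\max_(x : V) degree G x)%N.

(* Edges inside the intersection of A and B are counted twice. *)
Definition edge_count (V : finType) (G : simple_graph V) (A B : {set V}) : nat :=
  #|[set ab in finset.setX A B | adj G ab.1 ab.2]%SET|.

Section Dependency.
Context (R : realType) (dO dT : measure_display)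
  (O : measurableType dO) (T : measurableType dT) (P : probability O R)
  (I : finType).

(* The sigma-algebra generated by the variables X j for j in J. *)
Definition sigma_family (X : I -> {RV P >-> T}) (J : set I) : set (set O) :=
  <<s \bigcup_(j in J) preimage_set_system setT (X j) measurable >>.

Definition independent_of_family (X : I -> {RV P >-> T}) (i : I) (J : set I) :=
  forall E F : set O,
    sigma_family X [set i] E -> sigma_family X J F ->
    P (E `&` F) = (P E * P F)%E.

Definition dependency_graph (X : I -> {RV P >-> T}) (D : simple_graph I) :=
  forall i : I, independent_of_family X i [set j | j != i /\ ~~ adj D i j].

Definition locally_dependent (d : nat) (X : I -> {RV P >-> T}) :=
  exists D : simple_graph I, dependency_graph X D /\ (max_degree D <= d)%N.

End Dependency.

Section EdgeIndicator.
Context (V : finType) (e : potential_edge V).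

Definition edge_ind (G : simple_graph V) : bool := e \in edges G.

Lemma measurable_edge_ind : measurable_fun setT edge_ind.
Proof. by []. Qed.

HB.instance Definition _ :=
  isMeasurableFun.Build _ _ _ _ edge_ind measurable_edge_ind.

End EdgeIndicator.

(* [P] is a possible law of a d-dependent random graph G_{n,p,d}. *)
Definition dependent_random_graph (R : realType) (n : nat) (p : R) (d : nat)
    (P : probability (simple_graph 'I_n) R) : Prop :=
  (forall e : potential_edge 'I_n, P [set G | e \in edges G] = p%:E) /\
  locally_dependent d
    (fun e : potential_edge 'I_n => edge_ind e : {RV P >-> bool}).

(* "Almost surely" in the asymptotic sense: the probability tends to 1. *)
Definition asymp_almost_surely (R : realType)
    (P : forall n, probability (simple_graph 'I_n) R)
    (E : forall n, set (simple_graph 'I_n)) : Prop :=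
  (fun n => P n (E n)) @ \oo --> 1%:E.

(* Main.v *)
(* Chernoff plus a union bound over pairs of sets.  Properly colouring the
   dependency graph with d + 1 colours splits e(A,B) into sums of independent
   indicators; convexity of the exponential applied to the mean over the colours
   gives the independent moment generating function with every exponent divided
   by 2 (d + 1), the factor 2 coming from the edges that e(A,B) counts twice.
   The lower tail is then at most exp(-10 n), which beats the 4^n pairs.  For the
   upper tail take |A| <= |B| = b.  If C^2 n p |A| <= 196 b (d + 1), the bound
   e(A,B) <= |A| (C^2/14) n p from the maximum degree suffices.  Otherwise the
   tail is at most exp(-6 b (1 + ln (n/b))), which beats the number of pairs. *)
Require Import Defs.
From mathcomp Require Import all_boot all_order all_algebra.
From mathcomp Require Import all_classical all_reals all_analysis.
From mathcomp Require Import ring lra.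

Import Order.TTheory GRing.Theory Num.Theory.
Import numFieldNormedType.Exports.
Local Open Scope classical_set_scope.
Local Open Scope ring_scope.

(** * Exponential inequalities and the entropy of subsets *)

(** Weighting the tangent bounds for [expR ((1 - r) * x)] and [expR (- (r * x))] by [r] and [1 - r]
    cancels their linear terms. *)
Lemma expR_chord {R : realType} (r x : R) :
  0 <= r <= 1 -> expR (r * x) <= 1 + r * (expR x - 1).
Proof.
move=> /andP[r0 r1].
have hx : expR (r * x) * (1 + (1 - r) * x) <= expR x.
  have -> : expR x = expR (r * x) * expR ((1 - r) * x).
    by rewrite -expRD; congr expR; ring.
  by rewrite ler_pM2l ?expR_gt0// expR_ge1Dx.
have h1 : expR (r * x) * (1 - r * x) <= 1.
  rewrite -[leRHS](expRxMexpNx_1 (r * x)) ler_pM2l ?expR_gt0//.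
  exact: expR_ge1Dx.
have := lerD (ler_wpM2l r0 hx) (ler_wpM2l (_ : 0 <= 1 - r) h1).
by rewrite subr_ge0 => /(_ r1); lra.
Qed.

(** The difference of the two sides vanishes at 0, and its derivative is [r] times the gap in
    [expR_chord]. *)
Lemma expR_remainder_scale {R : realType} (r x : R) : 0 <= r <= 1 -> 0 <= x ->
  expR (r * x) - 1 - r * x <= r ^+ 2 * (expR x - 1 - x).
Proof.
move=> r01 x0.
pose f y := r ^+ 2 * (expR y - 1 - y) - (expR (r * y) - 1 - r * y).
have df (y : R) : is_derive y 1 f (r * (r * (expR y - 1) - (expR (r * y) - 1))).
  apply: is_derive_eq.
  rewrite /GRing.scale /=; ring.
suff : f 0 <= f x.
  by rewrite /f mulr0 expR0; lra.
apply: (@ger0_derive1_le_cc _ f 0 x) => //.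
- move=> y _; rewrite derive1E derive_val.
  have /andP[r0 _] := r01.
  by rewrite mulr_ge0// subr_ge0; have := expR_chord r y r01; lra.
- apply: continuous_subspaceT => y.
  by apply: differentiable_continuous; apply/derivable1_diffP.
- by rewrite in_itv /= lexx x0.
- by rewrite in_itv /= lexx x0.
Qed.

(** Multiplying by [expR x >= 1 + x] reduces this to [(1 - x + x^2) (1 + x) = 1 + x^3 >= 1]. *)
Lemma expRN_le_quadratic {R : realType} (x : R) :
  0 <= x -> expR (- x) <= 1 - x + x ^+ 2.
Proof.
move=> x0; rewrite expRN -[leLHS]mul1r ler_pdivrMr ?expR_gt0//.
have h : 0 <= 1 - x + x ^+ 2 by nra.
apply: le_trans (ler_wpM2l h (expR_ge1Dx x)).
have : 0 <= x ^+ 3 by rewrite exprn_ge0.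
by lra.
Qed.

(** The [m]-th power of [1 - x / m <= expR (- x / m)], inverted; it turns numerical bounds on [expR]
    into rational arithmetic. *)
Lemma expR_le_expn {R : realType} (x : R) (m : nat) :
  (0 < m)%N -> x < m%:R -> expR x <= (1 - x / m%:R) ^- m.
Proof.
move=> m0 xm.
have m0' : (0 : R) < m%:R by rewrite ltr0n.
have h : 0 < 1 - x / m%:R by rewrite subr_gt0 ltr_pdivrMr// mul1r.
have -> : expR x = expR (x / m%:R) ^+ m.
  by rewrite -expRM_natl mulrC divfK ?gt_eqF.
rewrite -exprVn.
rewrite lerXn2r ?nnegrE ?expR_ge0 ?invr_ge0 ?(ltW h)//.
rewrite -[leLHS]invrK lef_pV2 ?posrE ?invr_gt0 ?expR_gt0//.
by rewrite -expRN; exact: expR_ge1Dx.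
Qed.

(** The number 50/7 is [C ^+ 2 / 14] at [C = 10]; the value 13/7 is what produces the constant 6 in
    [upper_tail_exponent]. *)
Lemma ln_50_7 {R : realType} : 13 / 7 <= ln (50 / 7 : R).
Proof.
rewrite -ler_expR lnK ?posrE; last by lra.
(* The exponent 26 makes the base 13/14, and (14/13)^26 < 50/7. *)
apply: (le_trans (@expR_le_expn R (13 / 7) 26 _ _)) => //; first by lra.
have -> : 1 - 13 / 7 / 26%:R = (13 / 14 : R) by lra.
by rewrite -[leRHS]invrK lef_pV2 ?posrE; lra.
Qed.

(* [th = (14 / z) ln (C^2 u / 14)]; the bound does not depend on [z] because
   [(expR x - 1 - x) / x^2] is nondecreasing. *)
Lemma upper_tail_exponent {R : realType} (C u z : R) :
  10 <= C -> 1 <= u -> 14 <= z ->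
  exists2 th, 0 <= th &
    6 * (1 + ln u) <= (z * th - z ^+ 2 / (C ^+ 2 * u) * (expR th - 1 - th)) / 2.
Proof.
move=> hC hu hz.
have C2 : 100 <= C ^+ 2 by nra.
have Q0 : 0 < C ^+ 2 / 14 * u by nra.
have z0 : 0 < z by lra.
pose th0 := ln (C ^+ 2 / 14 * u).
have hth0 : 13 / 7 + ln u <= th0.
  rewrite /th0 lnM ?posrE; [|lra|lra].
  rewrite lerD2r; apply: le_trans ln_50_7 _.
  by rewrite ler_ln ?posrE; lra.
have lnu : 0 <= ln u by exact: ln_ge0.
have th00 : 0 <= th0 by lra.
exists (14 / z * th0); first by rewrite mulr_ge0// divr_ge0//; lra.
have r01 : 0 <= 14 / z <= 1.
  by rewrite divr_ge0 ?ler_pdivrMr//=; lra.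
have := expR_remainder_scale _ _ r01 th00.
rewrite {3}/th0 lnK ?posrE//.
set ph := expR _ - 1 - _ => hph.
have {}hph : z ^+ 2 * ph <= 196 * (C ^+ 2 / 14 * u).
  have -> : 196 * (C ^+ 2 / 14 * u) = z ^+ 2 * ((14 / z) ^+ 2 * (C ^+ 2 / 14 * u)).
    by field; lra.
  rewrite ler_pM2l ?exprn_gt0//; apply: le_trans hph _.
  by rewrite ler_wpM2l ?sqr_ge0//; lra.
have h1 : z ^+ 2 / (C ^+ 2 * u) * ph <= 14.
  rewrite mulrAC ler_pdivrMr; first by nra.
  by nra.
(* It remains that [14 * th0 - 14 >= 12 + 14 * ln u], half of which is at least [6 * (1 + ln u)]. *)
have -> : z * (14 / z * th0) = 14 * th0 by field; lra.
by lra.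
Qed.

(** The logarithm of the classical bound [(e n / b)^b] on ['C(n, b)]. *)
Definition subset_entropy {R : realType} (n b : nat) : R :=
  b%:R * (1 + ln (n%:R / b%:R)).

Section SubsetEntropy.
Context {R : realType}.
Local Notation g := (@subset_entropy R).

(** With [x = b / n], the term ['C(n, b) x^b] is part of the binomial expansion of [(1 + x)^n],
    which is at most [expR b]. *)
Lemma bin_subset_entropy (n b : nat) : (0 < b <= n)%N ->
  'C(n, b)%:R * expR (- g n b) <= 1.
Proof.
move=> /andP[b0 bn].
have b0' : (0 : R) < b%:R by rewrite ltr0n.
have n0' : (0 : R) < n%:R by rewrite ltr0n (leq_trans b0).
pose x : R := b%:R / n%:R.
have x0 : 0 < x by rewrite divr_gt0.
have -> : expR (- g n b) = x ^+ b * expR (- b%:R).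
  rewrite /subset_entropy mulrDr mulr1 opprD expRD mulrC; congr (_ * _).
  rewrite -mulrN -lnV ?posrE ?divr_gt0// invf_div expRM_natl lnK ?posrE//.
rewrite expRN mulrA ler_pdivrMr ?expR_gt0// mul1r.
apply: (@le_trans _ _ ((1 + x) ^+ n)).
  rewrite exprDn (bigD1 (inord b)) //= inordK ?ltnS//.
  rewrite expr1n mul1r mulr_natl lerDl sumr_ge0// => i _.
  by rewrite mulrn_wge0// expr1n mul1r exprn_ge0// ltW.
have -> : b%:R = n%:R * x by rewrite mulrC divfK ?gt_eqF.
rewrite expRM_natl lerXn2r ?nnegrE ?expR_ge0 ?expR_ge1Dx//.
by rewrite addr_ge0// ltW.
Qed.

(** From [a] to [b] the loss [a * ln (b / a)] is at most the gain [b - a], because [ln y <= y - 1];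
    what remains is [(b - a) * ln (n / b) >= 0]. *)
Lemma subset_entropy_le (n a b : nat) : (0 < a <= b)%N -> (b <= n)%N ->
  g n a <= g n b.
Proof.
move=> /andP[a0 ab] bn; rewrite /subset_entropy.
have a0' : (0 : R) < a%:R by rewrite ltr0n.
have ab' : (a%:R : R) <= b%:R by rewrite ler_nat.
have bn' : (b%:R : R) <= n%:R by rewrite ler_nat.
have b0' : (0 : R) < b%:R by lra.
have n0' : (0 : R) < n%:R by lra.
have -> : ln (n%:R / a%:R) = ln (n%:R / b%:R) + ln (b%:R / a%:R) :> R.
  by rewrite -lnM ?posrE ?divr_gt0//; congr ln; field; rewrite !gt_eqF.
have h1 : 0 <= ln (n%:R / b%:R : R).
  by apply: ln_ge0; rewrite ler_pdivlMr// mul1r.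
have h2 : ln (b%:R / a%:R : R) <= b%:R / a%:R - 1.
  have := expR_ge1Dx (ln (b%:R / a%:R : R)).
  by rewrite lnK ?posrE ?divr_gt0//; lra.
have h3 : a%:R * ln (b%:R / a%:R : R) <= b%:R - a%:R.
  apply: le_trans (ler_wpM2l (ltW a0') h2) _.
  by rewrite mulrBr mulr1 mulrCA divff ?gt_eqF// mulr1.
have h4 : 0 <= (b%:R - a%:R) * ln (n%:R / b%:R : R).
  by rewrite mulr_ge0// subr_ge0.
by lra.
Qed.

(** By monotonicity the worst case is [b = 1], where the left side is [1 / (e n)]. *)
Lemma subset_entropy_ge (n b : nat) : (0 < b <= n)%N ->
  expR (- g n b) <= n%:R^-1.
Proof.
move=> /andP[b0 bn].
have n0' : (0 : R) < n%:R by rewrite ltr0n (leq_trans b0).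
apply: (@le_trans _ _ (expR (- g n 1))).
  by rewrite ler_expR lerN2 subset_entropy_le.
rewrite /subset_entropy mul1r divr1 opprD expRD !expRN lnK ?posrE//.
rewrite ler_piMl ?invr_ge0 ?ler0n// invf_le1 ?expR_gt0//.
by have := expR_ge1Dx (1 : R); lra.
Qed.

(** Of the three factors [expR (- g n b)], one pays for the ['C(n, b)] sets of size [b]; the other
    two give [n^-2] for each of the [n] sizes. *)
Lemma sum_subset_entropy (n : nat) : (0 < n)%N ->
  \sum_(A : {set 'I_n} | A != finset.set0) expR (- 3 * g n #|A|) <= n%:R^-1.
Proof.
move=> n0.
have n0' : (0 : R) < n%:R by rewrite ltr0n.
have cardlt (A : {set 'I_n}) : (#|A| < n.+1)%N by rewrite ltnS -[leqRHS](card_ord n) max_card.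
rewrite (partition_big (fun A : {set 'I_n} => inord #|A| : 'I_n.+1)
   (fun b => b != ord0)) /=; last first.
  by move=> A; apply: contraNN => /eqP/(congr1 val)/=; rewrite inordK// => /eqP; rewrite cards_eq0.
apply: (@le_trans _ _ (\sum_(b : 'I_n.+1 | b != ord0) n%:R^-1 ^+ 2)).
  apply: ler_sum => b b0.
  have bb : (0 < b <= n)%N by rewrite lt0n b0 -ltnS ltn_ord.
  apply: (@le_trans _ _ (\sum_(A : {set 'I_n} | #|A| == b :> nat) expR (- 3 * g n b))).
    rewrite [leRHS](bigID (fun A => A != finset.set0)) /= ler_wpDr//.
      by apply: sumr_ge0 => *; exact: expR_ge0.
    rewrite le_eqVlt; apply/orP; left; apply/eqP; apply: eq_big => A.
      rewrite andbC; congr andb; apply/eqP/eqP => [<-|h]; first by rewrite inordK.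
      by apply: val_inj; rewrite /= inordK.
    by move=> /andP[_ /eqP <-]; rewrite inordK.
  rewrite sumr_const -[X in _ *+ X]/(#|[pred A : {set 'I_n} | #|A| == b]|).
  rewrite -cardsE card_draws card_ord.
  rewrite -(mulr_natl _ 'C(n, b)).
  have -> : expR (- 3 * g n b) = expR (- g n b) * expR (- g n b) ^+ 2.
    by rewrite -exprS -expRM_natl; congr expR; ring.
  rewrite mulrA -[leRHS]mul1r ler_pM ?mulr_ge0 ?ler0n ?expR_ge0 ?exprn_ge0 ?expR_ge0//.
    exact: bin_subset_entropy.
  by rewrite lerXn2r ?nnegrE ?expR_ge0 ?invr_ge0 ?ler0n ?subset_entropy_ge.
rewrite sumr_const.
have -> : #|[pred b : 'I_n.+1 | b != ord0]| = n.
  by rewrite -[n in RHS]/(n.+1.-1) -[in RHS](card_ord n.+1) (cardC1 ord0).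
by rewrite -[leLHS]mulr_natl expr2 mulrA divff ?gt_eqF// mul1r.
Qed.

End SubsetEntropy.

(** * Moment generating functions of dependent random graphs *)

(** Jensen's inequality: sum the tangent bounds of [expR] at the mean, where the deviations from the
    mean add up to zero. *)
Lemma expR_mean_le {R : realType} {I : finType} (x : I -> R) : (0 < #|I|)%N ->
  expR ((\sum_i x i) / #|I|%:R) <= (\sum_i expR (x i)) / #|I|%:R.
Proof.
move=> I0; set k : R := #|I|%:R.
have k0 : 0 < k by rewrite ltr0n.
set m := _ / k.
rewrite ler_pdivlMr//.
have hi (i : I) : expR m * (1 + (x i - m)) <= expR (x i).
  rewrite -{2}(subrKC m (x i)) expRD ler_pM2l ?expR_gt0//.
  exact: expR_ge1Dx.
apply: le_trans (ler_sum _ (fun i _ => hi i)).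
rewrite -mulr_sumr ler_pM2l ?expR_gt0// big_split /= sumrB !sumr_const.
have -> : \sum_i x i = m * k by rewrite divfK ?gt_eqF.
rewrite -[m *+ _]mulr_natr -/k addrC subrr add0r.
exact: lexx.
Qed.

(** * Expectation on the finite space of graphs *)

Section Expectation.
Context {R : realType} {V : finType} (P : probability (simple_graph V) R).

(** The space is finite and discrete, so a real-valued finite sum replaces the integral and
    exchanges with other sums freely. *)
Definition expect (f : simple_graph V -> R) : R :=
  \sum_(G : simple_graph V) fine (P [set G]) * f G.

Lemma prob_expect (E : set (simple_graph V)) :
  P E = (expect (fun G => (G \in E)%:R))%:E.
Proof.
have -> : E = \bigcup_(G in E) [set G] by rewrite bigcup_imset1 image_id.
rewrite measure_fin_bigcup; [|exact: finite_finset|by move=> G H _ _ [K [-> ->]]|by []].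
rewrite fsbig_mkcond (fsbigE (index_enum (simple_graph V))) ?index_enum_uniq//; last first.
  by move=> G _; rewrite mem_index_enum.
rewrite bigcup_imset1 image_id /expect -sumEFin.
apply: eq_big => G; first by rewrite in_setT.
move=> _; rewrite patchE; case: ifP => _ /=.
  by rewrite mulr1 fineK// fin_num_measure.
by rewrite mulr0.
Qed.

Lemma expect_ext (f g : simple_graph V -> R) : f =1 g -> expect f = expect g.
Proof. by move=> fg; apply: eq_bigr => G _; rewrite fg. Qed.

Lemma prob_expect_pred (b : pred (simple_graph V)) :
  P [set G | b G] = (expect (fun G => (b G)%:R))%:E.
Proof.
rewrite prob_expect; congr EFin; apply: expect_ext => G.
by congr (nat_of_bool _)%:R; apply/idP/idP => [/set_mem|/mem_set].
Qed.

Lemma le_expect (f g : simple_graph V -> R) :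
  (forall G, f G <= g G) -> expect f <= expect g.
Proof.
by move=> fg; apply: ler_sum => G _; rewrite ler_wpM2l// fine_ge0.
Qed.

Lemma expect1 : expect (fun=> 1) = 1.
Proof.
have := prob_expect setT; rewrite probability_setT => -[h]; rewrite [RHS]h.
by apply: expect_ext => G; rewrite in_setT.
Qed.

Lemma expectZ (c : R) (f : simple_graph V -> R) :
  expect (fun G => c * f G) = c * expect f.
Proof. by rewrite /expect mulr_sumr; apply: eq_bigr => G _; rewrite mulrCA. Qed.

Lemma expectD (f g : simple_graph V -> R) :
  expect (fun G => f G + g G) = expect f + expect g.
Proof. by rewrite /expect -big_split; apply: eq_bigr => G _; rewrite mulrDr. Qed.

Lemma expect_sum (I : finType) (Q : pred I) (f : I -> simple_graph V -> R) :
  expect (fun G => \sum_(i | Q i) f i G) = \sum_(i | Q i) expect (f i).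
Proof.
rewrite /expect exchange_big; apply: eq_bigr => G _.
by rewrite mulr_sumr.
Qed.

Lemma markov_expR (f : simple_graph V -> R) (x : R) :
  expect (fun G => (x <= f G)%R%:R) <= expR (- x) * expect (fun G => expR (f G)).
Proof.
rewrite -expectZ; apply: le_expect => G; rewrite -expRD.
case: (leP x (f G)) => h; last exact: expR_ge0.
by rewrite -expR0 ler_expR addrC subr_ge0.
Qed.

End Expectation.

(** The neighbours of a vertex carry at most [d] colours, so one of the [d + 1] colours is free for
    it. *)
Lemma greedy_coloring (I : finType) (D : simple_graph I) (d : nat) :
  (max_degree D <= d)%N ->
  exists col : I -> 'I_d.+1, forall i j, adj D i j -> col i != col j.
Proof.
move=> hd.
have adjC i j : adj D i j = adj D j i.
  by apply: eq_existsb => e; rewrite finset.setUC.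
have irr i : adj D i i = false.
  apply/negbTE/negP => /exists_inP[e _ /eqP he].
  by have := valP e; rewrite he finset.setUid cards1.
(* The colouring is total but proper only within a list, so each induction step has to watch only
   the new head. *)
suff [col hcol] : exists col : I -> 'I_d.+1,
    {in enum I &, forall i j, adj D i j -> col i != col j}.
  by exists col => i j; apply: hcol; rewrite mem_enum.
elim: (enum I) => [|i s [col hcol]]; first by exists (fun=> ord0).
pose N := [set col j | j in [set j | adj D i j]%SET]%SET.
have /existsP[c /negP cN] : [exists c, c \notin N].
  rewrite -negb_forall; apply/negP => /forallP allN.
  have : (#|'I_d.+1| <= #|N|)%N
    by apply: subset_leq_card; apply/fintype.subsetP => c _; exact: allN.
  rewrite card_ord; apply/negP; rewrite -ltnNge ltnS.
  apply: leq_trans (leq_imset_card _ _) _.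
  exact: leq_trans (leq_bigmax i) hd.
exists (fun j => if j == i then c else col j) => j l.
have colN m : adj D i m -> col m != c.
  move=> aim; apply/eqP => cm; apply: cN; rewrite -cm.
  by apply: imset_f; rewrite inE.
rewrite !inE; have [->|ji] := eqVneq j i; have [->|li] := eqVneq l i => //=.
- by rewrite irr.
- by move=> _ _ /colN; rewrite eq_sym.
- by move=> _ _; rewrite adjC => /colN.
- exact: hcol.
Qed.

Section DependentGraph.
Context {R : realType} {n : nat} (p : R) (d : nat)
  (P : probability (simple_graph 'I_n) R).
Local Notation edge := (potential_edge 'I_n).
Local Notation E := (expect P).

Definition edge_indicator (e : edge) (G : simple_graph 'I_n) : R :=
  (e \in edges G)%:R.
Local Notation X := edge_indicator.

(** Within a stable set the tail of the list consists of non-neighbours of its head, so the head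
    splits off as an independent factor. *)
Lemma prob_stable_edges (D : simple_graph edge) (s : seq edge) :
  (forall e : edge, P [set G | e \in edges G] = p%:E) ->
  dependency_graph (fun e : edge => edge_ind e : {RV P >-> bool}) D ->
  uniq s -> {in s &, forall e f, ~~ adj D e f} ->
  E (fun G => \prod_(e <- s) X e G) = p ^+ size s.
Proof.
move=> hp hD; elim: s => [|e s IH] /=.
  by move=> _ _; rewrite expr0 -[RHS](expect1 P); apply: expect_ext => G; rewrite big_nil.
move=> /andP[es us] st.
have [IHs IHst] : uniq s /\ {in s &, forall e f, ~~ adj D e f}.
  by split=> // f g fs gs; apply: st; rewrite inE ?fs ?gs orbT.
have probE (t : seq edge) :
    P [set G | all (fun f => f \in edges G) t] = (E (fun G => \prod_(e <- t) X e G))%:E.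
  rewrite prob_expect_pred; congr EFin; apply: expect_ext => G.
  elim: t => [|f t IHt]; rewrite ?big_nil//= big_cons -IHt /X -natrM mulnb //.
have := hD e [set G | e \in edges G] [set G | all (fun f => f \in edges G) s].
have -> : [set G | e \in edges G] `&` [set G | all (fun f => f \in edges G) s] =
    [set G | all (fun f => f \in edges G) (e :: s)].
  by apply/seteqP; split => G /= /andP.
rewrite !probE hp IH// -EFinM exprS => h; apply: EFin_inj; apply: h.
  apply: sub_sigma_algebra; exists e => //; exists [set true] => //.
  by rewrite setTI.
have sub : {subset s <= [pred j | (j != e) && ~~ adj D e j]}.
  move=> f fs; rewrite inE st ?inE ?eqxx ?fs ?orbT// andbT.
  by apply: contraNneq es => <-.
(* The joint presence of the tail is a finite intersection of generators. Measurability refers here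
   to the generated sigma-algebra, not to the discrete one. *)
elim: (s) sub => [|f t IHt] sub /=.
  have -> : [set _ : simple_graph 'I_n | true] = setT by apply/seteqP; split.
  exact: (@measurableT _ (g_sigma_algebraType _)).
have -> : [set G | (f \in edges G) && all (fun f => f \in edges G) t] =
  [set G | f \in edges G] `&` [set G | all (fun f => f \in edges G) t].
  by apply/seteqP; split => G /= /andP.
apply: (@measurableI _ (g_sigma_algebraType _)); last first.
  by apply: IHt => g gt; apply: sub; rewrite inE gt orbT.
apply: sub_sigma_algebra; exists f.
  by have /andP := sub f (mem_head _ _).
exists [set true] => //.
by rewrite setTI.
Qed.

(** The factors are expanded one at a time; [t] accumulates the edges whose indicator was chosen,
    which gives an induction hypothesis strong enough for both summands. *)
Lemma expect_prod_stable (D : simple_graph edge) (c : edge -> R) (s t : seq edge) :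
  (forall e : edge, P [set G | e \in edges G] = p%:E) ->
  dependency_graph (fun e : edge => edge_ind e : {RV P >-> bool}) D ->
  uniq (s ++ t) -> {in s ++ t &, forall e f, ~~ adj D e f} ->
  E (fun G => (\prod_(e <- t) X e G) * \prod_(e <- s) (1 + c e * X e G)) =
  p ^+ size t * \prod_(e <- s) (1 + c e * p).
Proof.
move=> hp hD; elim: s t => [|e s IH] t ust st.
  rewrite big_nil mulr1 -(prob_stable_edges D)//.
  by apply: expect_ext => G; rewrite big_nil mulr1.
have pcat : perm_eq (s ++ e :: t) ((e :: s) ++ t).
  by apply/permPl; exact: (perm_catCA s [:: e] t).
transitivity (E (fun G => (\prod_(e <- t) X e G) * \prod_(e <- s) (1 + c e * X e G))
  + c e * E (fun G => (\prod_(e <- e :: t) X e G) * \prod_(e <- s) (1 + c e * X e G))).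
  rewrite -expectZ -expectD; apply: expect_ext => G.
  by rewrite !big_cons; ring.
rewrite !IH ?big_cons /= ?exprS; first by ring.
- by rewrite (perm_uniq pcat).
- by move=> f g; rewrite !(perm_mem pcat); exact: st.
- by move: ust => /= /andP[].
- by move=> f g fs gs; apply: st; rewrite /= inE ?fs ?gs orbT.
Qed.

(* Colouring the dependency graph properly with [d + 1] colours makes the edges
   of each colour mutually independent; convexity of [expR] applied to the mean
   over the colours replaces Hoelder's inequality. *)
Lemma dependent_mgf (v : edge -> R) (th : R) : 0 <= p <= 1 ->
  dependent_random_graph p d P -> (forall e, 0 <= v e <= 1) ->
  E (fun G => expR (th * (\sum_e v e * X e G) / d.+1%:R)) <=
  expR (p * (\sum_e v e) * (expR th - 1) / d.+1%:R).
Proof.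
move=> /andP[p0 p1] [hp [D [hD Dd]]] hv.
have [col hcol] := greedy_coloring _ D d Dd.
pose Y j G : R := \sum_(e | col e == j) v e * X e G.
pose M j : R := p * \sum_(e | col e == j) v e.
pose y := expR th - 1.
have split (f : edge -> R) : \sum_e f e = \sum_j \sum_(e | col e == j) f e.
  by rewrite (partition_big col xpredT).
have class j : E (fun G => expR (th * Y j G)) <= expR (y * M j).
  have -> : E (fun G => expR (th * Y j G)) =
      \prod_(e <- enum [pred e | col e == j]) (1 + (expR (th * v e) - 1) * p).
    rewrite -[RHS]mul1r -(expr0 p) -(expect_prod_stable D _ _ [::])//; first last.
    - move=> e f; rewrite cats0 !mem_enum !inE => /eqP ce /eqP cf.
      by apply/negP => /hcol; rewrite ce cf eqxx.
    - by rewrite cats0 enum_uniq.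
    apply: expect_ext => G; rewrite big_nil mul1r /Y mulr_sumr expR_sum big_enum /=.
    (* On the values 0 and 1 of the indicator, the exponential agrees with an affine function. *)
    apply: eq_bigr => e _; rewrite /X; case: (e \in edges G).
      by rewrite !mulr1; ring.
    by rewrite !mulr0 expR0 addr0.
  rewrite big_enum /= /M mulr_sumr mulr_sumr expR_sum.
  apply: ler_prod => e _; apply/andP; split.
    have := expR_gt0 (th * v e); nra.
  apply: le_trans (expR_ge1Dx _).
  (* The chord bound makes the exponent linear in [v e], so that only the sum of the weights
     matters. *)
  have := expR_chord (v e) th (hv e); rewrite mulrC -/y => h.
  nra.
have k0 : (0 : R) < d.+1%:R by rewrite ltr0n.
(* The colour classes have different means, so each exponential is normalised to expectation at most
   1 before averaging over the colours. *)
rewrite -[leRHS]mul1r -ler_pdivrMr ?expR_gt0// -expRN mulrC -expectZ.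
have mean G : expR (- (p * (\sum_e v e) * (expR th - 1) / d.+1%:R)) *
    expR (th * (\sum_e v e * X e G) / d.+1%:R) <=
    (\sum_(j : 'I_d.+1) expR (- (y * M j)) * expR (th * Y j G)) / d.+1%:R.
  have := expR_mean_le (fun j : 'I_d.+1 => - (y * M j) + th * Y j G).
  rewrite card_ord => /(_ isT); under [X in _ <= X / _]eq_bigr do rewrite expRD.
  apply: le_trans; rewrite -expRD le_eqVlt; apply/orP; left; apply/eqP; congr expR.
  rewrite big_split /= -mulr_sumr -split sumrN -mulr_sumr -mulr_sumr -split -/y.
  by field; rewrite gt_eqF.
apply: le_trans (le_expect P _ _ mean) _.
under expect_ext do rewrite mulrC.
rewrite expectZ expect_sum mulrC ler_pdivrMr// mul1r.
rewrite -[X in _ <= X%:R](card_ord d.+1) -sum1_card natr_sum.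
apply: ler_sum => j _; rewrite expectZ expRN mulrC ler_pdivrMr ?expR_gt0// mul1r.
exact: class.
Qed.

End DependentGraph.

(** * Edge counts *)

Section EdgeCount.
Context {n : nat}.
Implicit Types (A B : {set 'I_n}) (G : simple_graph 'I_n).

(** The weight of [e] in e(A,B): it is 2 when both ends lie in [A :&: B], and otherwise 0 or 1. *)
Definition edge_multiplicity A B (e : potential_edge 'I_n) : nat :=
  #|[set ab in finset.setX A B | val e == [set ab.1; ab.2]%SET]%SET|.

Lemma adj_sum G x y :
  adj G x y = (\sum_(e : potential_edge 'I_n)
    (val e == [set x; y]%SET) * (e \in edges G))%N :> nat.
Proof.
case: (boolP (adj G x y)) => [/exists_inP[e eG /eqP exy]|/exists_inP nadj].
  rewrite (bigD1 e)//= exy eqxx eG big1// => f fe.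
  by rewrite -exy (inj_eq val_inj) (negPf fe).
rewrite big1// => e _; apply/eqP; rewrite muln_eq0 !eqb0 -negb_and.
by apply/negP => /andP[he eG]; apply: nadj; exists e.
Qed.

(** Double counting puts e(A,B) into the linear form in edge indicators that [dependent_mgf]
    treats. *)
Lemma edge_count_sum G A B : edge_count G A B =
  (\sum_(e : potential_edge 'I_n) edge_multiplicity A B e * (e \in edges G))%N.
Proof.
rewrite /edge_count -sum1_card.
transitivity (\sum_(ab in finset.setX A B) adj G ab.1 ab.2)%N.
  rewrite [RHS]big_mkcond [LHS]big_mkcond; apply: eq_bigr => ab _.
  by rewrite inE; case: (ab \in _) => //=; case: (adj _ _ _).
under eq_bigr do rewrite adj_sum.
rewrite exchange_big; apply: eq_bigr => e _.
rewrite -big_distrl /edge_multiplicity -sum1_card; congr (_ * _)%N.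
rewrite [RHS]big_mkcond [LHS]big_mkcond; apply: eq_bigr => ab _.
by rewrite inE; case: (ab \in _) => //=; case: (_ == _).
Qed.

Lemma edge_multiplicity_le2 A B e : (edge_multiplicity A B e <= 2)%N.
Proof.
have /cards2P[x [y [xy exy]]] := valP e.
apply: (@leq_trans #|[set (x, y); (y, x)]%SET|); last first.
  by rewrite cards2; case: (_ != _).
apply/subset_leq_card/fintype.subsetP => -[a b]; rewrite !inE /= exy.
move=> /andP[_ /eqP h].
have : x \in [set a; b]%SET by rewrite -h !inE eqxx.
have : y \in [set a; b]%SET by rewrite -h !inE eqxx orbT.
rewrite !inE !xpair_eqE => /orP[]/eqP ey /orP[]/eqP ex; move: xy; by rewrite ey ex !eqxx ?orbT.
Qed.

(** The sum is e(A,B) in the complete graph; the pairs it misses are the diagonal ones, indexed by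
    [A :&: B]. *)
Lemma sum_edge_multiplicity A B :
  (\sum_e edge_multiplicity A B e + #|A :&: B| = #|A| * #|B|)%N.
Proof.
have -> : (\sum_e edge_multiplicity A B e = edge_count [set: _]%SET A B)%N.
  by rewrite edge_count_sum; apply: eq_bigr => e _; rewrite /edges finset.in_setT muln1.
have adjT x y : adj ([set: _]%SET : simple_graph 'I_n) x y = (x != y).
  apply/exists_inP/idP => [[e _ /eqP he]|xy].
    by have := valP e; rewrite he cards2; case: (x != y).
  have h : #|[set x; y]%SET| == 2%N by rewrite cards2 xy.
  by exists (Sub [set x; y]%SET h : potential_edge 'I_n); rewrite ?SubK ?eqxx ?finset.in_setT.
rewrite /edge_count -cardsX -[RHS](cardsID [set ab | ab.1 != ab.2]%SET).
congr (_ + _)%N.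
  by apply: eq_card => ab; rewrite !inE adjT.
have inj : injective (fun x : 'I_n => (x, x)) by move=> x y [].
rewrite -(card_imset _ inj); apply: eq_card => -[x y]; rewrite !inE negbK /=.
apply/imsetP/andP => [[z]|[/eqP ->]].
  by rewrite inE => /andP[zA zB] [-> ->]; rewrite eqxx zA zB.
by move=> /andP[yA yB]; exists y => //; rewrite inE yA.
Qed.

Lemma edge_countC G A B : edge_count G A B = edge_count G B A.
Proof.
rewrite /edge_count.
have inj : injective (fun ab : 'I_n * 'I_n => (ab.2, ab.1)).
  by move=> [a b] [c e] [-> ->].
rewrite -(card_imset _ inj); apply: eq_card => -[x y].
apply/imsetP/idP => [[[a b]]|].
  rewrite !inE /= => /andP[/andP[aA bB] ab] [-> ->].
  by rewrite aA bB /adj finset.setUC.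
rewrite !inE /= => /andP[/andP[xB yA] xy]; exists (y, x) => //.
by rewrite !inE /= xB yA /adj finset.setUC.
Qed.

Lemma edge_count_degree G A B : (edge_count G A B <= #|A| * max_degree G)%N.
Proof.
rewrite -sum_nat_const /edge_count.
apply: (@leq_trans (\sum_(x in A) degree G x)); last first.
  by apply: leq_sum => x _; exact: leq_bigmax.
rewrite -sum1_card (partition_big fst (fun x => x \in A)); last first.
  by move=> [x y]; rewrite !inE => /andP[/andP[]].
apply: leq_sum => x xA; rewrite sum1_card.
have inj : injective (fun y : 'I_n => (x, y)) by move=> y z [].
rewrite /degree -(card_imset _ inj); apply/subset_leq_card/fintype.subsetP.
move=> [x' y]; rewrite unfold_in !inE /= => /andP[/andP[_ xy] /eqP ex].
by apply/imsetP; exists y; rewrite ?inE -ex.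
Qed.

(** This brings vertex degrees under the Chernoff bound for edge counts. *)
Lemma edge_count_star G x : edge_count G [set x]%SET [set: 'I_n]%SET = degree G x.
Proof.
have inj : injective (fun y : 'I_n => (x, y)) by move=> y z [].
rewrite /degree -(card_imset _ inj) /edge_count; apply: eq_card => -[x' y].
apply/idP/imsetP => [|[z]]; rewrite !inE /=.
  by move=> /andP[/andP[/eqP -> _] xy]; exists y; rewrite ?inE.
by move=> xz [-> ->]; rewrite eqxx xz.
Qed.

End EdgeCount.

(** * The Chernoff bound for edge counts and its exponents *)

Section Tails.
Context {R : realType} {n : nat} (p : R) (d : nat)
  (P : probability (simple_graph 'I_n) R).
Context (p01 : 0 <= p <= 1) (hP : dependent_random_graph p d P).
Local Notation E := (expect P).
Implicit Types (A B : {set 'I_n}).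

(** The sign of [th] selects the tail. Halved multiplicities lie in [0,1], as [dependent_mgf]
    requires, whence the factor 2 in the denominator. *)
Lemma edge_count_chernoff A B (th x : R) :
  E (fun G => (th * x <= th * (edge_count G A B)%:R)%R%:R) <=
  expR ((p * (#|A|%:R * #|B|%:R - #|A :&: B|%:R) * (expR th - 1) - th * x)
        / (2 * (d + 1)%:R)).
Proof.
have k0 : (0 : R) < (d + 1)%:R by rewrite ltr0n addn1.
pose v e : R := (edge_multiplicity A B e)%:R / 2.
have v01 e : 0 <= v e <= 1.
  rewrite divr_ge0 ?ler0n//= ler_pdivrMr// mul1r.
  by rewrite (ler_nat R _ 2) edge_multiplicity_le2.
have sumv : \sum_e v e = (#|A|%:R * #|B|%:R - #|A :&: B|%:R) / 2.
  rewrite -mulr_suml -natr_sum; congr (_ / _).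
  by rewrite -natrM -(sum_edge_multiplicity A B) natrD addrK.
have cnt G : th * (edge_count G A B)%:R / (2 * (d + 1)%:R) =
    th * (\sum_e v e * edge_indicator e G) / d.+1%:R.
  rewrite edge_count_sum natr_sum addn1.
  have -> : \sum_e v e * edge_indicator e G =
      (\sum_e (edge_multiplicity A B e * (e \in edges G))%:R) / 2.
    rewrite mulr_suml; apply: eq_bigr => e _.
    by rewrite /v /edge_indicator natrM mulrAC.
  by field; lra.
have := dependent_mgf p d P v th p01 hP v01.
rewrite sumv => mgf.
apply: (@le_trans _ _ (E (fun G => (th * x / (2 * (d + 1)%:R) <=
    th * (edge_count G A B)%:R / (2 * (d + 1)%:R))%R%:R))).
  apply: le_expect => G; rewrite ler_pM2r// invr_gt0; lra.
apply: le_trans (markov_expR _ _ _) _.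
have -> : E (fun G => expR (th * (edge_count G A B)%:R / (2 * (d + 1)%:R))) =
   E (fun G => expR (th * (\sum_e v e * edge_indicator e G) / d.+1%:R)).
  by apply: expect_ext => G; rewrite cnt.
rewrite [X in _ <= expR X]mulrBl [X in _ <= expR X]addrC expRD ler_pM2l ?expR_gt0//.
apply: le_trans mgf _; rewrite ler_expR addn1 le_eqVlt; apply/orP; left; apply/eqP.
by field; lra.
Qed.

End Tails.

(** This is [upper_tail_exponent] at [z = t / (k * b)] and [u = n / b], multiplied by [k * b]; the
    last hypothesis amounts to [z > 14]. *)
Lemma upper_chernoff_exponent {R : realType} (C p a b c n k t : R) :
  10 <= C -> 0 < a -> 0 < b <= n -> 0 <= c -> 0 < k -> 0 <= p -> 0 <= t ->
  t ^+ 2 = C ^+ 2 * (a * b * (n * p) * k) ->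
  196 * (b * k) < C ^+ 2 * (n * p * a) ->
  exists2 th, 0 <= th &
    (p * (a * b - c) * (expR th - 1) - th * (p * a * b + t)) / (2 * k) <=
    - (6 * (b * (1 + ln (n / b)))).
Proof.
move=> hC a0 /andP[b0 bn] c0 k0 p0 t0 ht hab.
have C0 : 0 < C by lra.
have n0 : 0 < n by lra.
pose z := t / (k * b); pose u := n / b.
have kb0 : 0 < k * b by rewrite mulr_gt0.
have tz : t = z * (k * b) by rewrite divfK ?gt_eqF.
have z0 : 0 <= z by rewrite divr_ge0// ltW.
have z2 : z ^+ 2 = C ^+ 2 * (n * p * a) / (b * k).
  by rewrite /z expr_div_n ht; field; lra.
have hz : 14 <= z.
  rewrite -(@ler_pXn2r _ 2) ?nnegrE// z2 ler_pdivlMr ?[b * k]mulrC//; lra.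
have hu : 1 <= u by rewrite ler_pdivlMr ?mul1r.
have [th th0 hth] := upper_tail_exponent C u z hC hu hz.
exists th => //.
have zu : z ^+ 2 / (C ^+ 2 * u) = p * a / k.
  by rewrite z2 /u; field; lra.
rewrite {}zu -/u in hth.
rewrite ler_pdivrMr ?mulr_gt0//.
have y0 : 0 <= expR th - 1 by rewrite subr_ge0 -expR0 ler_expR.
have h1 : p * (a * b - c) * (expR th - 1) <= p * (a * b) * (expR th - 1).
  by rewrite ler_wpM2r// ler_wpM2l// lerBlDr lerDl.
have h2 := ler_wpM2l (ltW kb0) hth.
have h3 : k * b * ((z * th - p * a / k * (expR th - 1 - th)) / 2) * 2 =
   t * th - p * a * b * (expR th - 1 - th).
  by rewrite tz; field; lra.
by rewrite -/u; lra.
Qed.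

(** A second-order bound on [expR (- y)] leaves [M y^2 - t y] plus a diagonal error of at most
    [p c y], where [M = p a b]. *)
Lemma lower_chernoff_exponent {R : realType} (C p a b c n k t : R) :
  10 <= C -> 1 <= a -> 1 <= b -> 1 <= n -> 0 <= c <= a -> c <= b -> 1 <= k ->
  0 < p <= 1 -> 0 <= t -> t ^+ 2 = C ^+ 2 * (a * b * (n * p) * k) ->
  exists2 y, 0 <= y &
    (p * (a * b - c) * (expR (- y) - 1) + y * (p * a * b - t)) / (2 * k) <=
    - (10 * n).
Proof.
move=> hC a1 b1 n1 /andP[c0 ca] cb k1 /andP[p0 p1] t0 ht.
have C2 : 100 <= C ^+ 2 by nra.
have ab1 : 1 <= a * b by nra.
pose M := p * a * b.
have M0 : 0 < M by rewrite /M; nra.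
have ht' : t ^+ 2 = C ^+ 2 * n * k * M by rewrite ht /M; ring.
have nk : 1 <= n * k by nra.
have t2M : 100 * M <= t ^+ 2.
  rewrite ht' ler_pM2r//; nra.
(* The diagonal is negligible: [(p c)^2 <= p a b = M], while [100 M <= t^2]. *)
have pc : 10 * (p * c) <= t.
  rewrite -(@ler_pXn2r _ 2) ?nnegrE ?mulr_ge0//; try lra.
  apply: le_trans t2M.
  have cc : c * c <= a * b by rewrite ler_pM//.
  have pp : p * p * (c * c) <= p * (a * b).
    by rewrite ler_pM ?mulr_ge0 ?ler_piMl ?(ltW p0).
  by rewrite /M; nra.
(* With [y = s t / M] and a tenth of [y t] lost to the diagonal, the gain is [s (9/10 - s) t^2 / M],
   largest at [s = 9/20]. It is then at least [(81/4) n k], enough for [20 n k]. *)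
pose y := 9 / 20 * (t / M).
have tM0 : 0 <= t / M by rewrite divr_ge0// ltW.
have y0 : 0 <= y by rewrite mulr_ge0//; lra.
exists y => //.
rewrite ler_pdivrMr; last by lra.
have pm0 : 0 <= p * (a * b - c) by rewrite mulr_ge0//; nra.
have h1 := ler_wpM2l pm0 (expRN_le_quadratic y y0).
have yM : y * M = 9 / 20 * t by rewrite /y; field; lra.
have yt : y * t = 9 / 20 * (C ^+ 2 * n * k).
  have -> : y * t = 9 / 20 * (t ^+ 2 / M) by rewrite /y; ring.
  by rewrite ht'; field; lra.
have h2 : p * c * (y - y ^+ 2) <= y * t / 10.
  have pc0 : 0 <= p * c by rewrite mulr_ge0//; lra.
  have : 0 <= p * c * y ^+ 2 by rewrite mulr_ge0// sqr_ge0.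
  have := ler_wpM2r y0 pc.
  by lra.
have h3 : M * y ^+ 2 = 9 / 20 * (y * t).
  have -> : M * y ^+ 2 = y * M * y by ring.
  by rewrite yM; ring.
have h4 : 100 * (n * k) <= C ^+ 2 * n * k.
  by rewrite -mulrA ler_wpM2r//; lra.
have : p * (a * b - c) * (1 - y + y ^+ 2 - 1) = - (y * M) + M * y ^+ 2 + p * c * (y - y ^+ 2).
  by rewrite /M; ring.
have : y * (p * a * b - t) = y * M - y * t by rewrite /M; ring.
have : (p * (a * b - c)) * (expR (- y) - 1) <= p * (a * b - c) * (1 - y + y ^+ 2 - 1).
  by move: h1; lra.
by lra.
Qed.

(** Taking [th = 1] suffices: [e - 1 <= 3] and [3 - 50/7 <= -4], so the exponent is at most
    [- 2 n p / k]. *)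
Lemma degree_chernoff_exponent {R : realType} (p m n k x l : R) :
  0 <= p -> 0 <= n -> 0 < k -> m <= n -> 50 / 7 * (n * p) <= x -> k * l <= n * p ->
  (p * m * (expR 1 - 1) - 1 * x) / (2 * k) <= - (2 * l).
Proof.
move=> p0 n0 k0 mn hx hl.
have e4 : expR 1 <= 4 :> R.
  apply: (le_trans (@expR_le_expn R 1 2 isT _)); first by rewrite ltr1n.
  have -> : 1 - 1 / 2%:R = 2%:R^-1 :> R by lra.
  by rewrite exprVn invrK; lra.
have e1 : 0 <= expR 1 - 1 :> R by have := expR_ge1Dx (1 : R); lra.
have h1 := ler_wpM2r e1 (ler_wpM2l p0 mn).
have np0 : 0 <= p * n by rewrite mulr_ge0.
have h2 : p * n * (expR 1 - 1) <= p * n * 3 by rewrite ler_wpM2l//; lra.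
by rewrite ler_pdivrMr; lra.
Qed.

(** * Tail bounds and the union bound *)

Lemma ler_bool {R : numDomainType} (b c : bool) :
  (b -> c) -> b%:R <= c%:R :> R.
Proof. by case: b; case: c => //= /(_ isT). Qed.

Section Discrepancy.
Context {R : realType} {n : nat} (C p : R) (d : nat)
  (P : probability (simple_graph 'I_n) R).
Context (hC : 10 <= C) (p01 : 0 <= p <= 1) (hP : dependent_random_graph p d P).
Local Notation E := (expect P).
Local Notation k := ((d + 1)%:R : R).
Implicit Types (A B : {set 'I_n}) (G : simple_graph 'I_n).

Definition deviation A B : R :=
  C * Num.sqrt (#|A|%:R * #|B|%:R * (n%:R * p) * (d + 1)%:R).

Let p0 : 0 <= p. Proof. by case/andP: p01. Qed.

Lemma deviation_ge0 A B : 0 <= deviation A B.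
Proof.
have C0 : 0 <= C by apply: le_trans hC; rewrite ler0n.
exact: mulr_ge0 C0 (sqrtr_ge0 _).
Qed.

Lemma deviation_sqr A B :
  deviation A B ^+ 2 = C ^+ 2 * (#|A|%:R * #|B|%:R * (n%:R * p) * k).
Proof. by rewrite exprMn sqr_sqrtr// !mulr_ge0. Qed.

Lemma card_le_order A : (#|A| <= n)%N.
Proof. by rewrite -[leqRHS](card_ord n) max_card. Qed.

(* For the other pairs the upper bound follows from the maximum degree. *)
Definition large_mean A B :=
  (0 < #|A| <= #|B|)%N && (196 * (#|B|%:R * k) < C ^+ 2 * (n%:R * p * #|A|%:R)).

Lemma upper_tail A B : large_mean A B ->
  E (fun G => (p * #|A|%:R * #|B|%:R + deviation A B <= (edge_count G A B)%:R)%R%:R) <=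
  expR (- 6 * subset_entropy n #|B|).
Proof.
move=> /andP[/andP[A0 AB] hAB].
have [th th0 hth] : exists2 th, 0 <= th &
    (p * (#|A|%:R * #|B|%:R - #|A :&: B|%:R) * (expR th - 1)
      - th * (p * #|A|%:R * #|B|%:R + deviation A B)) / (2 * k) <=
    - (6 * (#|B|%:R * (1 + ln (n%:R / #|B|%:R)))).
  apply: (upper_chernoff_exponent C) => //.
  - by rewrite ltr0n.
  - by rewrite ltr0n (leq_trans A0)// ler_nat card_le_order.
  - exact: deviation_ge0.
  - exact: deviation_sqr.
apply: (le_trans _ (le_trans (edge_count_chernoff p d P p01 hP A B th
  (p * #|A|%:R * #|B|%:R + deviation A B)) _)).
  by apply: le_expect => G; apply: ler_bool => h; rewrite ler_wpM2l.
by rewrite ler_expR mulNr.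
Qed.

Lemma lower_tail A B : 0 < p * #|A|%:R * #|B|%:R ->
  E (fun G => ((edge_count G A B)%:R <= p * #|A|%:R * #|B|%:R - deviation A B)%R%:R) <=
  expR (- (10 * n%:R)).
Proof.
move=> M0.
have pp : 0 < p by rewrite lt0r p0 andbT; apply: contraTneq M0 => ->; rewrite !mul0r ltxx.
have A0 : (0 < #|A|)%N.
  by rewrite lt0n; apply: contraTneq M0 => ->; rewrite mulr0 mul0r ltxx.
have B0 : (0 < #|B|)%N.
  by rewrite lt0n; apply: contraTneq M0 => ->; rewrite mulr0 ltxx.
have [y y0 hy] : exists2 y, 0 <= y &
    (p * (#|A|%:R * #|B|%:R - #|A :&: B|%:R) * (expR (- y) - 1)
      + y * (p * #|A|%:R * #|B|%:R - deviation A B)) / (2 * k) <= - (10 * n%:R).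
  apply: (lower_chernoff_exponent C) => //.
  - by rewrite ler1n.
  - by rewrite ler1n.
  - by rewrite ler1n (leq_trans A0)// card_le_order.
  - by rewrite ler0n ler_nat subset_leq_card// finset.subsetIl.
  - by rewrite ler_nat subset_leq_card// finset.subsetIr.
  - by rewrite ler1n addn1.
  - by case/andP: p01 => _ ->; rewrite pp.
  - exact: deviation_ge0.
  - exact: deviation_sqr.
apply: (le_trans _ (le_trans (edge_count_chernoff p d P p01 hP A B (- y)
  (p * #|A|%:R * #|B|%:R - deviation A B)) _)).
  by apply: le_expect => G; apply: ler_bool => h; rewrite !mulNr lerN2 ler_wpM2l.
by rewrite ler_expR [- y * (_ - _)]mulNr opprK.
Qed.

(** A boolean form of the conclusion, so that its indicator can stand under [expect]. *)
Definition discrepancy_bound G :=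
  [forall A : {set 'I_n}, [forall B : {set 'I_n},
    `|(edge_count G A B)%:R - p * #|A|%:R * #|B|%:R| <= deviation A B]].

(** The deterministic step: an excess of edges must exceed the deviation yet respect the degree
    bound on e(A,B), and comparing the two forces [large_mean]. *)
Lemma discrepancy_failure G :
  (max_degree G)%:R <= C ^+ 2 / 14 * (n%:R * p) -> ~~ discrepancy_bound G ->
  (exists A B, large_mean A B /\
    p * #|A|%:R * #|B|%:R + deviation A B <= (edge_count G A B)%:R) \/
  (exists A B, 0 < p * #|A|%:R * #|B|%:R /\
    (edge_count G A B)%:R <= p * #|A|%:R * #|B|%:R - deviation A B).
Proof.
move=> hdeg; rewrite negb_forall => /existsP[A]; rewrite negb_forall => /existsP[B].
rewrite -ltNge => hAB.
have [h|h] := leP ((edge_count G A B)%:R) (p * #|A|%:R * #|B|%:R).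
  right; exists A, B; move: hAB; rewrite ler0_norm ?subr_le0// opprB => hAB.
  split; last by lra.
  have := deviation_ge0 A B; have : (0 : R) <= (edge_count G A B)%:R by rewrite ler0n.
  by lra.
move: hAB; rewrite gtr0_norm ?subr_gt0// => hAB; left.
wlog AB : A B h hAB / (#|A| <= #|B|)%N.
  move=> hw; have [AB|/ltnW AB] := leqP #|A| #|B|; first exact: (hw A B).
  apply: (hw B A) => //; first by rewrite edge_countC mulrAC.
  by rewrite edge_countC mulrAC /deviation [#|B|%:R * _]mulrC.
exists A, B; split; last by lra.
have hcount : (edge_count G A B)%:R <= #|A|%:R * (C ^+ 2 / 14 * (n%:R * p)).
  apply: (@le_trans _ _ (#|A|%:R * (max_degree G)%:R)).
    by rewrite -natrM ler_nat edge_count_degree.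
  by rewrite ler_wpM2l.
have M0 : 0 <= p * #|A|%:R * #|B|%:R by rewrite !mulr_ge0.
have devlt : deviation A B < #|A|%:R * (C ^+ 2 / 14 * (n%:R * p)) by lra.
have Q0 : 0 < #|A|%:R * (C ^+ 2 / 14 * (n%:R * p)).
  exact: le_lt_trans (deviation_ge0 A B) devlt.
have A0 : (0 < #|A|)%N.
  by rewrite lt0n; apply: contraTneq Q0 => ->; rewrite mul0r ltxx.
rewrite /large_mean A0 AB /=.
have := devlt; rewrite -(@ltr_pXn2r _ 2) ?nnegrE ?deviation_ge0 ?(ltW Q0)//.
rewrite deviation_sqr; set a : R := #|A|%:R; set b : R := #|B|%:R; set N : R := n%:R.
(* Both squares share the positive factor [a * (C ^+ 2 / 14 * (N * p)) / 14]; cancelling it leaves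
   exactly the inequality in [large_mean]. *)
have -> : (a * (C ^+ 2 / 14 * (N * p))) ^+ 2 =
   (a * (C ^+ 2 / 14 * (N * p))) / 14 * (C ^+ 2 * (N * p * a)) by field.
have -> : C ^+ 2 * (a * b * (N * p) * k) =
   (a * (C ^+ 2 / 14 * (N * p))) / 14 * (196 * (b * k)) by field.
by rewrite ltr_pM2l// divr_gt0//; lra.
Qed.

(** Since [#|A| <= #|B|], the exponent 6 splits into 3 for each set, and the double sum is bounded
    by the square of the sum in [sum_subset_entropy]. *)
Lemma sum_upper : (0 < n)%N ->
  \sum_A \sum_(B | large_mean A B) expR (- 6 * @subset_entropy R n #|B|) <= n%:R^-1.
Proof.
move=> n0.
have n1 : (n%:R^-1 : R) <= 1 by rewrite invf_le1 ?ltr0n// ler1n.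
have i0 : (0 : R) <= n%:R^-1 by rewrite invr_ge0 ler0n.
pose s : R := \sum_(A : {set 'I_n} | A != finset.set0) expR (- 3 * subset_entropy n #|A|).
have s0 : 0 <= s by apply: sumr_ge0 => *; exact: expR_ge0.
have hs : s <= n%:R^-1 by exact: sum_subset_entropy.
apply: (@le_trans _ _ (s * s)); last by nra.
rewrite {1}/s mulr_suml [leRHS]big_mkcond /=; apply: ler_sum => A _.
case: eqP => [->|/eqP A0] /=.
  by rewrite big_pred0// => B; rewrite /large_mean cards0.
rewrite mulr_sumr [leLHS]big_mkcond [leRHS]big_mkcond /=; apply: ler_sum => B _.
case: ifP => [/andP[/andP[hA AB] _]|_]; last first.
  by case: ifP => // _; rewrite mulr_ge0 ?expR_ge0.
have -> : B != finset.set0 by rewrite -cards_eq0 -lt0n (leq_trans hA).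
rewrite -expRD ler_expR.
have : subset_entropy n #|A| <= subset_entropy n #|B| :> R.
  by rewrite subset_entropy_le ?hA ?card_le_order.
by lra.
Qed.

Lemma sum_lower : (0 < n)%N ->
  \sum_(A : {set 'I_n}) \sum_(B : {set 'I_n}) expR (- (10 * n%:R)) <= n%:R^-1 :> R.
Proof.
move=> n0.
have cset : #|{set 'I_n}| = (2 ^ n)%N.
  by rewrite -cardsT -powersetT card_powerset cardsT card_ord.
rewrite !sumr_const -mulrnA cset -[leLHS]mulr_natl.
have n0' : (0 : R) < n%:R by rewrite ltr0n.
(* The base 4 is [1 + 3 <= expR 3], so the union over all pairs costs only [3 n] of the [10 n]. *)
have h4 : (2 ^ n * 2 ^ n)%:R <= expR (3 * n%:R) :> R.
  rewrite -expnMn natrX mulrC expRM_natl lerXn2r ?nnegrE ?expR_ge0 ?ler0n//.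
  by have := expR_ge1Dx (3 : R); lra.
apply: (@le_trans _ _ (expR (3 * n%:R) * expR (- (10 * n%:R)))).
  by rewrite ler_wpM2r ?expR_ge0.
rewrite -expRD.
have -> : 3 * n%:R - 10 * n%:R = - (7 * n%:R) :> R by ring.
rewrite expRN lef_pV2 ?posrE ?expR_gt0//.
by have := expR_ge1Dx (7 * n%:R : R); lra.
Qed.

(** The union bound, written as a pointwise inequality between indicators; each tail contributes
    [1 / n]. *)
Lemma discrepancy_prob : (0 < n)%N ->
  E (fun G => ((max_degree G)%:R <= C ^+ 2 / 14 * (n%:R * p))%R%:R) <=
  E (fun G => (discrepancy_bound G)%:R) + 2 / n%:R.
Proof.
move=> n0.
pose U A B G : R :=
  (p * #|A|%:R * #|B|%:R + deviation A B <= (edge_count G A B)%:R)%R%:R.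
pose L A B G : R :=
  ((edge_count G A B)%:R <= p * #|A|%:R * #|B|%:R - deviation A B)%R%:R.
pose pos A B := 0 < p * #|A|%:R * #|B|%:R.
apply: (@le_trans _ _ (E (fun G => (discrepancy_bound G)%:R +
  (\sum_A \sum_(B | large_mean A B) U A B G + \sum_A \sum_(B | pos A B) L A B G)))).
  apply: le_expect => G.
  have U0 : 0 <= \sum_A \sum_(B | large_mean A B) U A B G.
    by do 2![apply: sumr_ge0 => ? _]; exact: ler0n.
  have L0 : 0 <= \sum_A \sum_(B | pos A B) L A B G.
    by do 2![apply: sumr_ge0 => ? _]; exact: ler0n.
  case: (leP (max_degree G)%:R (C ^+ 2 / 14 * (n%:R * p))) => [hdeg|_]; last first.
    exact: addr_ge0 (ler0n _ _) (addr_ge0 U0 L0).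
  have [_|nbound] := boolP (discrepancy_bound G); first by rewrite lerDl addr_ge0.
  rewrite [X in _ <= X + _](_ : _ = 0)// add0r.
  have [[A [B [hAB hG]]]|[A [B [hAB hG]]]] := discrepancy_failure G hdeg nbound.
    rewrite ler_wpDr// (bigD1 A)//= (bigD1 B)//= {1}/U hG -addrA lerDl addr_ge0//.
      by apply: sumr_ge0 => ? _; exact: ler0n.
    by do 2![apply: sumr_ge0 => ? _]; exact: ler0n.
  rewrite ler_wpDl// (bigD1 A)//= (bigD1 B)//= {1}/L hG -addrA lerDl addr_ge0//.
    by apply: sumr_ge0 => ? _; exact: ler0n.
  by do 2![apply: sumr_ge0 => ? _]; exact: ler0n.
rewrite !expectD lerD2l.
have -> : 2 / n%:R = n%:R^-1 + n%:R^-1 :> R by ring.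
apply: lerD.
  rewrite expect_sum; apply: le_trans (sum_upper n0).
  apply: ler_sum => A _; rewrite expect_sum; apply: ler_sum => B hAB.
  exact: upper_tail.
rewrite expect_sum; apply: le_trans (sum_lower n0).
apply: ler_sum => A _; rewrite expect_sum [leLHS]big_mkcond; apply: ler_sum => B _ /=.
by case: ifP => hAB; [exact: lower_tail|exact: expR_ge0].
Qed.

Lemma degree_tail v : (0 < n)%N -> k * ln n%:R <= n%:R * p ->
  E (fun G => (C ^+ 2 / 14 * (n%:R * p) <= (degree G v)%:R)%R%:R) <= n%:R^-1 / n%:R.
Proof.
move=> n0 nln.
have C2 : 100 <= C ^+ 2 by move: hC; nra.
apply: (le_trans _ (le_trans (edge_count_chernoff p d P p01 hP
    [set v]%SET [set: 'I_n]%SET 1 (C ^+ 2 / 14 * (n%:R * p))) _)).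
  by apply: le_expect => G; apply: ler_bool; rewrite edge_count_star !mul1r.
have -> : n%:R^-1 / n%:R = expR (- (2 * ln n%:R)) :> R.
  by rewrite expRN expRM_natl lnK ?posrE ?ltr0n// expr2 invfM.
rewrite ler_expR; apply: (degree_chernoff_exponent _ _ n%:R) => //.
- by rewrite cards1 cardsT card_ord mul1r lerBlDr lerDl.
- by rewrite ler_wpM2r ?mulr_ge0//; lra.
Qed.

(** In the first case the degree bound is at least [n], hence always true; in the second, [n]
    vertices each fail with probability at most [n^-2]. The error [2 / n] is the one expected by
    [asymp_almost_surely_le]. *)
Lemma max_degree_prob : (0 < n)%N ->
  14 / C ^+ 2 <= p \/ k * ln n%:R / n%:R <= p ->
  1 <= E (fun G => ((max_degree G)%:R <= C ^+ 2 / 14 * (n%:R * p))%R%:R) + 2 / n%:R.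
Proof.
move=> n0 hp.
have n0' : (0 : R) < n%:R by rewrite ltr0n.
have C2 : 0 < C ^+ 2 by move: hC; nra.
rewrite -[leLHS](expect1 P).
case: hp => hp.
  apply: (@le_trans _ _ (E (fun G =>
      ((max_degree G)%:R <= C ^+ 2 / 14 * (n%:R * p))%R%:R))); last first.
    by rewrite lerDl divr_ge0.
  apply: le_expect => G; apply: (ler_bool true) => _.
  apply: (@le_trans _ _ n%:R).
    rewrite ler_nat; apply/bigmax_leqP => v _.
    exact: card_le_order.
  rewrite mulrCA ler_peMr ?ler0n// -ler_pdivrMl ?divr_gt0//.
  by rewrite invf_div mulr1.
have nln : k * ln n%:R <= n%:R * p by rewrite -ler_pdivrMl// mulrC.
apply: (@le_trans _ _ (E (fun G =>
    ((max_degree G)%:R <= C ^+ 2 / 14 * (n%:R * p))%R%:R +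
    \sum_v (C ^+ 2 / 14 * (n%:R * p) <= (degree G v)%:R)%R%:R))).
  apply: le_expect => G.
  case: (leP (max_degree G)%:R (C ^+ 2 / 14 * (n%:R * p))) => hG.
    by rewrite lerDl sumr_ge0.
  have [|v hv] := @bigop.eq_bigmax ('I_n : finType) (degree G); first by rewrite card_ord.
  rewrite /max_degree hv in hG.
  by rewrite ler_wpDl// (bigD1 v)//= (ltW hG) lerDl sumr_ge0.
rewrite expectD lerD2l expect_sum.
apply: (@le_trans _ _ (\sum_(v : 'I_n) n%:R^-1 / n%:R)).
  by apply: ler_sum => v _; exact: degree_tail.
rewrite sumr_const card_ord -[leLHS]mulr_natl mulrC divfK ?gt_eqF//.
by rewrite -[leLHS]mul1r ler_pM2r ?invr_gt0// ler1n.
Qed.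

End Discrepancy.

(** * Passage to the limit *)

Lemma asymp_almost_surely_le {R : realType}
    (P : forall n, probability (simple_graph 'I_n) R)
    (F G : forall n, set (simple_graph 'I_n)) :
  (forall n, (0 < n)%N -> (P n (F n) <= P n (G n) + (2 / n%:R)%:E)%E) ->
  asymp_almost_surely P F -> asymp_almost_surely P G.
Proof.
move=> FG hF; rewrite /asymp_almost_surely.
(* As [harmonic n] is [1 / (n + 1)], the factor 4 makes it dominate [2 / n] for all [n >= 1]. *)
have h0 : (fun n : nat => (4 * harmonic n : R)%:E) @ \oo --> (0 : R)%:E.
  apply: cvg_EFin; first exact: nearW.
  rewrite -(mulr0 4); apply: cvgMr; exact: cvg_harmonic.
apply: (@squeeze_cvge _ _ _ _ (fun n => P n (F n) - (4 * harmonic n : R)%:E)%E _ (cst 1%E)).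
- near=> n; rewrite probability_le1// andbT leeBlDr//.
  have n0 : (0 < n)%N by near: n; exists 1%N.
  apply: le_trans (FG n n0) _.
  rewrite leeD2l// lee_fin /harmonic /=.
  rewrite ler_pdivrMr ?ltr0n// mulrAC ler_pdivlMr ?ltr0n//.
  rewrite -natr1; have : (1 : R) <= n%:R by rewrite ler1n.
  by lra.
- rewrite -[X in _ --> X]sube0; apply: cvgeB => //.
- exact: cvg_cst.
Unshelve. all: by end_near.
Qed.

Theorem theorem3 (R : realType) (C : R) (d : nat -> nat) (p : nat -> R)
    (P : forall n : nat, probability (simple_graph 'I_n) R)
    (hC : 10 <= C)
    (hp : forall n : nat, 0 <= p n <= 1)
    (hP : forall n : nat, dependent_random_graph (p n) (d n) (P n)) :
  (asymp_almost_surely P (fun n =>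
     [set G | (max_degree G)%:R <= C ^+ 2 / 14 * (n%:R * p n)]) ->
   asymp_almost_surely P (fun n =>
     [set G | forall A B : {set 'I_n},
        `| (edge_count G A B)%:R - p n * #|A|%:R * #|B|%:R |
        <= C * Num.sqrt (#|A|%:R * #|B|%:R * (n%:R * p n) * (d n + 1)%:R)]))
  /\
  ((forall n : nat, (0 < n)%N ->
      14 / C ^+ 2 <= p n \/ (d n + 1)%:R * ln n%:R / n%:R <= p n) ->
   asymp_almost_surely P (fun n =>
     [set G | (max_degree G)%:R <= C ^+ 2 / 14 * (n%:R * p n)])).
Proof.
split.
  apply: asymp_almost_surely_le => n n0.
  have -> : [set G | forall A B : {set 'I_n},
        `| (edge_count G A B)%:R - p n * #|A|%:R * #|B|%:R |
        <= C * Num.sqrt (#|A|%:R * #|B|%:R * (n%:R * p n) * (d n + 1)%:R)] =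
      [set G | discrepancy_bound C (p n) (d n) G].
    apply/seteqP; split => G /= h.
      by apply/forallP => A; apply/forallP => B; exact: h.
    by move=> A B; move/forallP: h => /(_ A)/forallP; exact.
  rewrite !prob_expect_pred -EFinD lee_fin.
  exact: discrepancy_prob.
(* The comparison is with the sure event, of constant probability 1. *)
move=> hlarge; apply: (asymp_almost_surely_le P (fun=> setT)) => [n n0|].
  rewrite probability_setT prob_expect_pred -EFinD lee_fin.
  by apply: (max_degree_prob C _ (d n)) => //; exact: hlarge.
rewrite /asymp_almost_surely.
rewrite (_ : (fun n => P n setT) = cst 1%E); first exact: cvg_cst.
by apply/funext => n; rewrite probability_setT.
Qed.
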